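(* In $\mathbb S$, let $\mathcal S$ be the class of stab-surjective 1-cells and $\mathcal E$ the class of equivariant 1-cells. Then: (0) Each of $\mathcal S$ and $\mathcal E$ is closed under composition. (1) For any 1-cell $\alpha\colon\frac XG\to\frac YH$ there exist a 0-cell $\frac ZH$, a stab-surjective 1-cell $s\colon\frac XG\to\frac ZH$, an $H$-equivariant 1-cell $u\colon\frac ZH\to\frac YH$, and a 2-cell $u\circ s\Rightarrow\alpha$. (2) Let $\alpha\colon\frac XG\to\frac YH$ and $\beta\colon\frac XG\to\frac{Y'}H$ be stab-surjective 1-cells, let $\frac\gamma H\colon\frac YH\to\frac ZH$ and $\frac\delta H\colon\frac{Y'}H\to\frac ZH$ be $H$-equivariant 1-cells, and let $\varepsilon\colon\gamma\circ\alpha\Rightarrow\delta\circ\beta$ be a 2-cell. Then: (i) There exists a triplet $(\omega,\mu,\nu)$ of a 1-cell $\omega\colon\frac YH\to\frac{Y'}H$ and 2-cells $\mu\colon\omega\circ\alpha\Rightarrow\beta$, $\nu\colon\delta\circ\omega\Rightarrow\gamma$ satisfying $\delta\circ\mu=\varepsilon\cdot(\nu\circ\alpha)$. (ii) For any other triplet $(\omega',\mu',\nu')$ as in (i), there exists a unique 2-cell $\zeta\colon\omega\Rightarrow\omega'$ satisfying $\mu'\cdot(\zeta\circ\alpha)=\mu$ and $\nu'\cdot(\delta\circ\zeta)=\nu$. (3) The 1-cell $\omega$ in (2) is an equivalence. More precisely, $\omega$ can be taken to be ($H$-equivariant and given by) an isomorphism of $H$-sets $\omega\colon Y\xrightarr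ow{\cong}Y'$.
   Context: All groups and group-sets are finite. **The 2-category $\mathbb S$.** A 0-cell is a pair $\frac XG$ of a finite group $G$ and a finite left $G$-set $X$. A 1-cell $\alpha=\frac{\alpha}{\theta_\alpha}\colon \frac XG\to\frac YH$ is a map $\alpha\colon X\to Y$ together with a family $\theta_\alpha=\{\theta_{\alpha,x}\colon G\to H\}_{x\in X}$ of maps such that $\alpha(gx)=\theta_{\alpha,x}(g)\alpha(x)$ and $\theta_{\alpha,x}(gg')=\theta_{\alpha,g'x}(g)\,\theta_{\alpha,x}(g')$ for all $x\in X$, $g,g'\in G$. The composite $\beta\circ\alpha$ is the composite of maps with $\theta_{\beta\circ\alpha,x}=\theta_{\beta,\alpha(x)}\circ\theta_{\alpha,x}$; the identity has $\theta_x=\mathrm{id}_G$. A 2-cell $\varepsilon\colon\alpha\Rightarrow\alpha'$ between 1-cells $\alpha,\alpha'\colon\frac XG\to\frac YH$ is a map $X\to H$, $x\mapsto\varepsilon_x$, with $\alpha'(x)=\varepsilon_x\alpha(x)$ and $\varepsilon_{gx}\theta_{\alpha,x}(g)\varepsilon_x^{-1}=\theta_{\alpha',x}(g)$. Vertical composition: $(\varepsilon'\cdot\varepsilon)_x=\varepsilon'_x\varepsilon_x$; all 2-cells are invertible. Whiskering: $(\beta\circ\varepsilon)_x=\theta_{\beta,\alpha(x)}(\varepsilon_x)$ and $(\delta\circ\alpha)_x=\delta_{\alpha(x)}$. A 1-cell $\frac XG\to\frac YG$ is ($G$-)equivariant if $\theta_{\alpha,x}=\mathrm{id}_G$ for all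 $x$ (so it is an ordinary $G$-map); it is written $\frac\alpha G$. A 1-cell $\alpha$ is an equivalence if there are a 1-cell $\beta$ in the opposite direction and 2-cells $\mathrm{id}\Rightarrow\beta\circ\alpha$, $\alpha\circ\beta\Rightarrow\mathrm{id}$. **Stab-surjective 1-cells.** A 1-cell $\alpha\colon\frac XG\to\frac YH$ is stab-surjective if (i) for every $y\in Y$ there are $x\in X$, $h\in H$ with $y=h\alpha(x)$; (ii) whenever $x,x'\in X$, $h,h'\in H$ satisfy $h\alpha(x)=h'\alpha(x')$, there is $g\in G$ with $x'=gx$ and $h=h'\theta_{\alpha,x}(g)$. *)

(* Defs.v *)
From HB Require Import structures.
From mathcomp Require Import all_boot all_fingroup.

Set Implicit Arguments.
Unset Strict Implicit.
Unset Printing Implicit Defensive.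

Local Open Scope group_scope.

(* Finite left G-sets. The actions of action.v are right actions. *)
Record gset (G : finGroupType) := GSet {
  gset_sort :> finType;
  lact : G -> gset_sort -> gset_sort;
  lact1 : forall x, lact 1 x = x;
  lactM : forall g g' x, lact (g * g') x = lact g (lact g' x) }.

Notation "g ** x" := (lact g x) (at level 40, left associativity).

(* The 0-cell X/G is given by G : finGroupType and X : gset G.

   The data of a 1-cell is kept apart from its laws. Composition of data is
   associative by conversion, and 2-cells (below) are indexed by data, so that
   2-cells into or out of c o (b o a) and (c o b) o a have the same type and can
   be compared by Leibniz equality without transport. *)
Record data1 (G H : finGroupType) (X : gset G) (Y : gset H) := Data1 {
  map1 :> X -> Y;
  theta : X -> G -> H }.

Record cell1 (G H : finGroupType) (X : gset G) (Y : gset H) := Cell1 {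
  cell1_data :> data1 X Y;
  map1_act : forall x g,
    cell1_data (g ** x) = theta cell1_data x g ** cell1_data x;
  thetaM : forall x g g',
    theta cell1_data x (g * g')
      = theta cell1_data (g' ** x) g * theta cell1_data x g' }.

Section OneCells.

Variables (G H K : finGroupType) (X : gset G) (Y : gset H) (Z : gset K).

Definition id1_data : data1 X X := Data1 id (fun _ => id).

Fact id1_act x g : id1_data (g ** x) = theta id1_data x g ** id1_data x.
Proof. by []. Qed.

Fact id1_thetaM x g g' :
  theta id1_data x (g * g')
    = theta id1_data (g' ** x) g * theta id1_data x g'.
Proof. by []. Qed.

Definition id1 : cell1 X X := Cell1 id1_act id1_thetaM.

Definition comp1_data (b : data1 Y Z) (a : data1 X Y) : data1 X Z :=
  Data1 (fun x => b (a x)) (fun x g => theta b (a x) (theta a x g)).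

Variables (b : cell1 Y Z) (a : cell1 X Y).

Fact comp1_act x g :
  comp1_data b a (g ** x) = theta (comp1_data b a) x g ** comp1_data b a x.
Proof. by rewrite /= !map1_act. Qed.

Fact comp1_thetaM x g g' :
  theta (comp1_data b a) x (g * g')
    = theta (comp1_data b a) (g' ** x) g * theta (comp1_data b a) x g'.
Proof. by rewrite /= !thetaM map1_act. Qed.

Definition comp1 : cell1 X Z := Cell1 comp1_act comp1_thetaM.

End OneCells.

Arguments id1 {G} X.

Notation "b \o1 a" := (comp1 b a) (at level 50, left associativity).

Section TwoCells.

Variables (G H : finGroupType) (X : gset G) (Y : gset H).

Definition is_cell2 (a a' : data1 X Y) (e : {ffun X -> H}) : bool :=
  [forall x, (a' x == e x ** a x) &&
    [forall g, e (g ** x) * theta a x g * (e x)^-1 == theta a' x g]].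

Record cell2 (a a' : data1 X Y) := Cell2 {
  cell2_fun :> {ffun X -> H};
  cell2_law : is_cell2 a a' cell2_fun }.

HB.instance Definition _ (a a' : data1 X Y) :=
  [isSub for @cell2_fun a a'].

Lemma eq_cell2 (a a' : data1 X Y) (e e' : cell2 a a') : e =1 e' -> e = e'.
Proof. by move=> ee'; apply/val_inj/ffunP. Qed.

Lemma is_cell2P (a a' : data1 X Y) (e : {ffun X -> H}) :
  reflect ((forall x, a' x = e x ** a x) /\
           (forall x g, e (g ** x) * theta a x g * (e x)^-1 = theta a' x g))
          (is_cell2 a a' e).
Proof.
apply: (iffP forallP) => [h | [h1 h2] x].
  by split=> [x | x g]; have /andP[/eqP ? /forallP h'] := h x; last exact/eqP.
by apply/andP; split; [apply/eqP | apply/forallP=> g; apply/eqP].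
Qed.

Fact vcomp_subproof (a a' a'' : data1 X Y) (e' : cell2 a' a'')
    (e : cell2 a a') :
  is_cell2 a a'' [ffun x => e' x * e x].
Proof.
have /is_cell2P[e'1 e'2] := cell2_law e'.
have /is_cell2P[e1 e2] := cell2_law e.
apply/is_cell2P; split=> [x | x g]; rewrite !ffunE.
  by rewrite e'1 e1 lactM.
by rewrite -e'2 -e2 invMg !mulgA.
Qed.

Definition vcomp (a a' a'' : data1 X Y) (e' : cell2 a' a'') (e : cell2 a a') :
  cell2 a a'' := Cell2 (vcomp_subproof e' e).

End TwoCells.

Section Whiskering.

Variables (G H K : finGroupType) (X : gset G) (Y : gset H) (Z : gset K).

Fact whiskl_subproof (b : cell1 Y Z) (a a' : cell1 X Y) (e : cell2 a a') :
  is_cell2 (b \o1 a) (b \o1 a') [ffun x => theta b (a x) (e x)].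
Proof.
have /is_cell2P[e1 e2] := cell2_law e.
apply/is_cell2P; split=> [x | x g]; rewrite !ffunE /=.
  by rewrite e1 map1_act.
apply: (canLR (mulgK _)).
rewrite -e2 e1 map1_act -!thetaM.
by rewrite mulgKV.
Qed.

Definition whiskl (b : cell1 Y Z) (a a' : cell1 X Y) (e : cell2 a a') :
  cell2 (b \o1 a) (b \o1 a') := Cell2 (whiskl_subproof b e).

Fact whiskr_subproof (b b' : cell1 Y Z) (d : cell2 b b') (a : cell1 X Y) :
  is_cell2 (b \o1 a) (b' \o1 a) [ffun x => d (a x)].
Proof.
have /is_cell2P[d1 d2] := cell2_law d.
apply/is_cell2P; split=> [x | x g]; rewrite !ffunE /=.
  exact: d1.
by rewrite map1_act d2.
Qed.

Definition whiskr (b b' : cell1 Y Z) (d : cell2 b b') (a : cell1 X Y) :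
  cell2 (b \o1 a) (b' \o1 a) := Cell2 (whiskr_subproof d a).

End Whiskering.

Definition equivariant (G : finGroupType) (X Y : gset G) (a : cell1 X Y) :=
  forall x g, theta a x g = g.

Definition equivalence1 (G H : finGroupType) (X : gset G) (Y : gset H)
    (a : cell1 X Y) :=
  exists b : cell1 Y X,
    inhabited (cell2 (id1 X) (b \o1 a)) /\ inhabited (cell2 (a \o1 b) (id1 Y)).

Definition stab_surj (G H : finGroupType) (X : gset G) (Y : gset H)
    (a : cell1 X Y) :=
  (forall y, exists x h, y = h ** a x) /\
  (forall x x' h h', h ** a x = h' ** a x' ->
     exists g, x' = g ** x /\ h = h' * theta a x g).

Definition lifting (G H : finGroupType) (X : gset G) (Y Y' Z : gset H)
    (a : cell1 X Y) (b : cell1 X Y') (c : cell1 Y Z) (d : cell1 Y' Z)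
    (e : cell2 (c \o1 a) (d \o1 b))
    (w : cell1 Y Y') (m : cell2 (w \o1 a) b) (n : cell2 (d \o1 w) c) :=
  whiskl d m = vcomp e (whiskr n a).

(* Main.v *)
Require Import Defs.
From HB Require Import structures.
From mathcomp Require Import all_boot all_fingroup.

(** A stab-surjective 1-cell [a : X/G -> Y/H] exhibits [Y] as the [H]-set
    induced from [X] along [theta a]: the first condition says that every point of [Y]
    is some [h ** a x], and the second says that two such expressions agree
    only when the cocycle law of [theta a] forces them to. So an [H]-map out
    of [Y] amounts to a map [f] out of [X] with
    [f (g ** x) = theta a x g ** f x] ([stab_surj_extend],
    [equivariant_eq]), and everything follows from this universal property.

    For the factorization of an arbitrary [a], the induced [H]-set is built by
    hand as the quotient of [H * X] that makes [x |-> [1, x]] stab-surjective,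
    and [a] itself extends along this map.

    For the lifting, the condition on a triple [(w, m, n)] reads
    [m x = e x * n (a x)], because [d] is equivariant. Asking for an equivariant
    [w] and [n = 1] leaves [m = e] and [w (a x) = (e x)^-1 ** b x], which is a
    legitimate map to extend; exchanging [a] and [b] produces the inverse of
    [w]. Given two triples, the equation on [n] and [n'] forces
    [z y = (n' y)^-1 * n y]. That this is compatible with the [theta] holds
    because [c] and [d] are equivariant, so that [n] and [n'] conjugate
    [theta w] and [theta w'] to the same identity family; that it carries [w y]
    to [w' y] is checked at the points [y = a x], where [m] and [m'] provide it,
    and propagates to every [h ** a x] by the compatibility with the [theta].
    Any [w] in a triple is thereby isomorphic to the bijective equivariant one,
    hence is an equivalence. *)

Set Implicit Arguments.
Unset Strict Implicit.
Unset Printing Implicit Defensive.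

Local Open Scope group_scope.
Local Open Scope quotient_scope.

(** * Cells *)

Section Cells.

Variables (G H : finGroupType) (X : gset G) (Y : gset H).

Lemma lactK (h : H) : cancel (@lact H Y h) (lact h^-1).
Proof. by move=> y; rewrite -lactM mulVg lact1. Qed.

Lemma cell2_map (a a' : data1 X Y) (e : cell2 a a') x : a' x = e x ** a x.
Proof. by have /is_cell2P[] := cell2_law e. Qed.

Lemma cell2_theta (a a' : data1 X Y) (e : cell2 a a') x g :
  e (g ** x) * theta a x g = theta a' x g * e x.
Proof.
by have /is_cell2P[_ <-] := cell2_law e; rewrite mulgKV.
Qed.

Lemma cell2_build (a a' : data1 X Y) (e : X -> H) :
    (forall x, a' x = e x ** a x) ->
    (forall x g, e (g ** x) * theta a x g = theta a' x g * e x) ->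
  exists e' : cell2 a a', e' =1 e.
Proof.
move=> e1 e2; have ec : is_cell2 a a' [ffun x => e x]; last first.
  by exists (Cell2 ec) => x; rewrite /= ffunE.
by apply/is_cell2P; split=> [x | x g]; rewrite !ffunE // e2 mulgK.
Qed.

(** Replaces function extensionality: data that agrees pointwise need not be
    equal, but it is 2-isomorphic, which is all that is ever required. *)
Lemma cell2_eq1 (a a' : data1 X Y) :
    a =1 a' -> (forall x, theta a x =1 theta a' x) ->
  exists e : cell2 a a', forall x, e x = 1.
Proof.
move=> eq_map eq_theta.
have [x | x g | e eE] := @cell2_build a a' (fun=> 1); last by exists e.
  by rewrite lact1 eq_map.
by rewrite mul1g mulg1 eq_theta.
Qed.

End Cells.

Lemma equivariant_act (G : finGroupType) (X Y : gset G) (a : cell1 X Y) :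
  equivariant a -> forall g x, a (g ** x) = g ** a x.
Proof. by move=> eqv_a g x; rewrite map1_act eqv_a. Qed.

Lemma equivariant_build (G : finGroupType) (X Y : gset G) (f : X -> Y) :
    (forall g x, f (g ** x) = g ** f x) ->
  exists a : cell1 X Y, equivariant a /\ a =1 f.
Proof.
move=> fJ; pose D := Data1 f (fun=> id).
have Dact x g : D (g ** x) = theta D x g ** D x by exact: fJ.
have DM x g g' :
  theta D x (g * g') = theta D (g' ** x) g * theta D x g' by [].
by exists (Cell1 Dact DM).
Qed.

(** * The universal property of stab-surjective 1-cells *)

Lemma stab_surj_comp (G H K : finGroupType) (X : gset G) (Y : gset H)
    (Z : gset K) (a : cell1 X Y) (b : cell1 Y Z) :
  stab_surj a -> stab_surj b -> stab_surj (b \o1 a).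
Proof.
move=> [a_surj a_stab] [b_surj b_stab]; split=> [z | x x' k k' /b_stab].
  have [y [k ->]] := b_surj z; have [x [h ->]] := a_surj y.
  by exists x, (k * theta b (a x) h); rewrite lactM -map1_act.
case=> h [ax'E ->]; have [|g [-> ->]] := a_stab x x' h 1.
  by rewrite lact1.
by exists g; rewrite mul1g.
Qed.

Section UniversalProperty.

Variables (G H : finGroupType) (X : gset G) (Y : gset H) (a : cell1 X Y).
Hypothesis a_ss : stab_surj a.

(** The existence half of the universal property: [h ** a x |-> h ** f x] is
    well defined by the second condition of stab-surjectivity. *)
Lemma stab_surj_extend (Y' : gset H) (f : X -> Y') :
    (forall x g, f (g ** x) = theta a x g ** f x) ->
  exists w : cell1 Y Y', equivariant w /\ forall x, w (a x) = f x.
Proof.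
have [a_surj a_stab] := a_ss => fJ.
have ex_rep y : exists p : H * X, y == p.1 ** a p.2.
  by have [x [h ->]] := a_surj y; exists (h, x).
pose rep y := xchoose (ex_rep y).
have repE y : y = (rep y).1 ** a (rep y).2 by apply/eqP/(xchooseP (ex_rep y)).
pose w0 y := (rep y).1 ** f (rep y).2.
have w0E h x : w0 (h ** a x) = h ** f x.
  have [g [xE hE]] := a_stab _ _ _ _ (repE (h ** a x)).
  by rewrite /w0 xE fJ -lactM -hE.
have [|w [eqv_w wE]] := @equivariant_build _ _ _ w0.
  by move=> h y; rewrite {1}(repE y) -lactM w0E lactM.
by exists w; split=> // x; rewrite wE -[a x]lact1 w0E lact1.
Qed.

(** The uniqueness half of the universal property. *)
Lemma equivariant_eq (Y' : gset H) (w w' : cell1 Y Y') :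
    equivariant w -> equivariant w' -> (forall x, w (a x) = w' (a x)) ->
  w =1 w'.
Proof.
have [a_surj _] := a_ss => eqv_w eqv_w' eq_ww' y.
by have [x [h ->]] := a_surj y; rewrite !equivariant_act ?eq_ww'.
Qed.

End UniversalProperty.

(** * Factorization *)

Section Induced.

Variables (G H : finGroupType) (X : gset G) (Y : gset H) (a : cell1 X Y).

(** [(h * theta a x g, x)] and [(h, g ** x)] must be identified, both being sent
    to [h ** a (g ** x)]; these identifications already form an equivalence
    relation. *)
Definition induced_rel : rel (H * X) := fun p q =>
  [exists g, (q.2 == g ** p.2) && (p.1 == q.1 * theta a p.2 g)].

Lemma induced_relP (p q : H * X) :
  reflect (exists g, q.2 = g ** p.2 /\ p.1 = q.1 * theta a p.2 g)
          (induced_rel p q).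
Proof.
apply: (iffP existsP) => [] [g gP]; exists g.
  by have /andP[/eqP ? /eqP] := gP.
by apply/andP; split; apply/eqP; case: gP.
Qed.

Lemma theta1 x : theta a x 1 = 1.
Proof.
apply: (mulIg (theta a x 1)); rewrite mul1g.
by rewrite -{1}(lact1 x) -thetaM mulg1.
Qed.

Lemma induced_equiv : equiv_class_of induced_rel.
Proof.
have sym_imp p q : induced_rel p q -> induced_rel q p.
  case/induced_relP=> g [q2E p1E]; apply/induced_relP; exists g^-1.
  rewrite p1E q2E lactK -mulgA; split=> //.
  by rewrite -{1}(lactK g p.2) -q2E -thetaM mulgV theta1 mulg1.
split=> [p | p q | q p r].
- by apply/induced_relP; exists 1; rewrite lact1 theta1 mulg1.
- by apply/idP/idP; apply: sym_imp.
case/induced_relP=> g [q2E p1E] /induced_relP[g' [r2E q1E]].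
apply/induced_relP; exists (g' * g).
by rewrite lactM -q2E thetaM -q2E mulgA -q1E.
Qed.

Canonical induced_equiv_rel := EquivRelPack induced_equiv.

(** The alias [quot_type] identifies the quotient with the set of canonical
    representatives, and this is what makes it a finite type. *)
Definition induced_type : finType := quot_type {eq_quot induced_rel}.

Definition induced_pi (p : H * X) : induced_type := \pi_{eq_quot induced_rel} p.

Lemma induced_piP p q : reflect (induced_pi p = induced_pi q) (induced_rel p q).
Proof. exact: eqmodP. Qed.

Lemma induced_piW (P : induced_type -> Prop) :
  (forall h x, P (induced_pi (h, x))) -> forall c, P c.
Proof. by move=> Ppi; apply: quotW => -[]. Qed.

Definition induced_act (h : H) (c : induced_type) : induced_type :=
  let p := generic_quotient.repr (c : {eq_quot induced_rel}) in
  induced_pi (h * p.1, p.2).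

(** Left multiplication commutes with the identifications, which act on the
    right of [h]; so it does not depend on the representative. *)
Lemma induced_actE h h' x :
  induced_act h (induced_pi (h', x)) = induced_pi (h * h', x).
Proof.
rewrite /induced_act; set p := generic_quotient.repr _.
have /induced_piP/induced_relP[g [/= xE p1E]] :
  induced_pi p = induced_pi (h', x) by exact: reprK.
by apply/induced_piP/induced_relP; exists g; rewrite /= p1E mulgA.
Qed.

Lemma induced_act1 c : induced_act 1 c = c.
Proof. by elim/induced_piW: c => h x; rewrite induced_actE mul1g. Qed.

Lemma induced_actM h h' c :
  induced_act (h * h') c = induced_act h (induced_act h' c).
Proof. by elim/induced_piW: c => k x; rewrite !induced_actE mulgA. Qed.

Definition induced : gset H := GSet induced_act1 induced_actM.

Definition to_induced_data : data1 X induced :=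
  Data1 (fun x => induced_pi (1, x) : induced) (theta a).

Lemma to_induced_act x g :
  to_induced_data (g ** x) = theta to_induced_data x g ** to_induced_data x.
Proof.
rewrite /= induced_actE mulg1; apply/esym/induced_piP/induced_relP.
by exists g; rewrite mul1g.
Qed.

Definition to_induced : cell1 X induced :=
  @Cell1 _ _ _ _ to_induced_data to_induced_act (thetaM a).

Lemma to_induced_stab_surj : stab_surj to_induced.
Proof.
split=> [c | x x' h h' /=].
  by elim/induced_piW: c => h x; exists x, h; rewrite /= induced_actE mulg1.
by rewrite !induced_actE !mulg1 => /induced_piP/induced_relP.
Qed.

Lemma stab_surj_equivariant_factor :
  exists (Z : gset H) (s : cell1 X Z) (u : cell1 Z Y),
    stab_surj s /\ equivariant u /\ inhabited (cell2 (u \o1 s) a).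
Proof.
have [u [eqv_u us]] := stab_surj_extend to_induced_stab_surj (map1_act a).
exists induced, to_induced, u; split; first exact: to_induced_stab_surj.
split=> //; have [||e _] := @cell2_eq1 _ _ _ _ (u \o1 to_induced) a => //.
by move=> x g; apply: eqv_u.
Qed.

End Induced.

(** * Lifting *)

Section Lifting.

Variables (G H : finGroupType) (X : gset G) (Y Y' Z : gset H).
Variables (a : cell1 X Y) (b : cell1 X Y') (c : cell1 Y Z) (d : cell1 Y' Z).
Variable e : cell2 (c \o1 a) (d \o1 b).
Hypotheses (a_ss : stab_surj a) (b_ss : stab_surj b).
Hypotheses (eqv_c : equivariant c) (eqv_d : equivariant d).

Lemma liftingP (w : cell1 Y Y') (m : cell2 (w \o1 a) b)
    (n : cell2 (d \o1 w) c) :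
  lifting e m n <-> forall x, m x = e x * n (a x).
Proof.
split=> [lift_w x | mE].
  by have := congr1 (fun t : cell2 _ _ => t x) lift_w; rewrite /= !ffunE eqv_d.
by apply: eq_cell2 => x; rewrite /= !ffunE eqv_d.
Qed.

(** Because [c] and [d] are equivariant, [e] relates [theta a] directly to
    [theta b]; this is what makes both [x |-> (e x)^-1 ** b x] and
    [x |-> e x ** a x] extend to maps between [Y] and [Y']. *)
Lemma theta_conj x g : e (g ** x) * theta a x g = theta b x g * e x.
Proof. by have := cell2_theta e x g; rewrite /= eqv_c eqv_d. Qed.

(** The two extensions [a x |-> (e x)^-1 ** b x] and [b x |-> e x ** a x] are
    mutually inverse by uniqueness. *)
Lemma exists_bijective_lifting :
  exists (w : cell1 Y Y') (m : cell2 (w \o1 a) b) (n : cell2 (d \o1 w) c),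
    lifting e m n /\ equivariant w /\ bijective w.
Proof.
have [x g | w [eqv_w wE]] :=
    @stab_surj_extend _ _ _ _ _ a_ss _ (fun x => (e x)^-1 ** b x).
  rewrite map1_act -!lactM; congr (_ ** _).
  by apply: (canRL (mulgK _)); rewrite -mulgA -theta_conj mulKg.
have [x g | v [eqv_v vE]] :=
    @stab_surj_extend _ _ _ _ _ b_ss _ (fun x => e x ** a x).
  by rewrite map1_act -!lactM theta_conj.
have wK : cancel w v.
  apply: (@equivariant_eq _ _ _ _ _ a_ss _ (v \o1 w) (id1 Y)) => //.
  - by move=> y h; rewrite /= eqv_w eqv_v.
  by move=> x; rewrite /= wE equivariant_act // vE lactK.
have vK : cancel v w.
  apply: (@equivariant_eq _ _ _ _ _ b_ss _ (w \o1 v) (id1 Y')) => //.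
  - by move=> y h; rewrite /= eqv_v eqv_w.
  by move=> x; rewrite /= vE equivariant_act // wE -lactM mulgV lact1.
have [x | x g | m mE] := @cell2_build _ _ _ _ (w \o1 a) b e.
- by rewrite /= wE -lactM mulgV lact1.
- by rewrite /= eqv_w theta_conj.
have [||n nE] := @cell2_eq1 _ _ _ _ (d \o1 w) c.
- apply: (@equivariant_eq _ _ _ _ _ a_ss _ (d \o1 w) c) => //.
    by move=> y h; rewrite /= eqv_w eqv_d.
  move=> x; rewrite /= wE equivariant_act //.
  by have /= -> := cell2_map e x; rewrite lactK.
- by move=> y h; rewrite /= eqv_w eqv_d eqv_c.
exists w, m, n; split; first by apply/liftingP => x; rewrite mE nE mulg1.
by split; last exists v.
Qed.

Section TwoLiftings.

Variables (w w' : cell1 Y Y').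
Variables (m : cell2 (w \o1 a) b) (n : cell2 (d \o1 w) c).
Variables (m' : cell2 (w' \o1 a) b) (n' : cell2 (d \o1 w') c).
Hypotheses (lift_w : lifting e m n) (lift_w' : lifting e m' n').

(** The triangle with [n] and [n'] determines [z]; the one with [m] and [m'] is
    then automatic, since both liftings factor the same [e]. *)
Lemma exists_lifting_cell2 :
  exists! z : cell2 w w',
    vcomp m' (whiskr z a) = m /\ vcomp n' (whiskl d z) = n.
Proof.
have [a_surj _] := a_ss.
have /liftingP mE := lift_w; have /liftingP m'E := lift_w'.
(* The only solution of [n' y * z y = n y]. *)
pose z0 y := (n' y)^-1 * n y.
have z0_theta y h : z0 (h ** y) * theta w y h = theta w' y h * z0 y.
  have /= := cell2_theta n y h; have /= := cell2_theta n' y h.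
  rewrite !eqv_c !eqv_d => n'th nth.
  rewrite -mulgA nth !mulgA; congr (_ * _).
  by apply: (canLR (mulKg _)); rewrite mulgA n'th mulgK.
have z0_a x : w' (a x) = z0 (a x) ** w (a x).
  rewrite -[LHS](lactK (m' x)); have /= <- := cell2_map m' x.
  have /= -> := cell2_map m x.
  by rewrite -lactM m'E mE invMg mulgA mulgKV.
have [y | y h | z zE] := @cell2_build _ _ _ _ w w' z0.
- have [x [h ->]] := a_surj y.
  by rewrite !map1_act z0_a -!lactM z0_theta.
- exact: z0_theta.
exists z; split=> [|z' [_ n'z']].
  split; apply: eq_cell2 => x; rewrite /= !ffunE ?eqv_d zE /z0.
    by rewrite m'E mE -mulgA mulKVg.
  by rewrite mulKVg.
apply: eq_cell2 => y; rewrite zE /z0.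
by rewrite -n'z' /= !ffunE eqv_d mulKg.
Qed.

End TwoLiftings.

(** The inverse of the bijective lifting is an inverse of [w] up to the 2-cells
    that compare the two liftings, one for each direction. *)
Lemma lifting_equivalence1 (w : cell1 Y Y') (m : cell2 (w \o1 a) b)
    (n : cell2 (d \o1 w) c) :
  lifting e m n -> equivalence1 w.
Proof.
move=> lift_w.
have [w0 [m0 [n0 [lift_w0 [eqv_w0 [v0 w0K v0K]]]]]] := exists_bijective_lifting.
have [z _] := exists_lifting_cell2 lift_w0 lift_w.
have [z' _] := exists_lifting_cell2 lift_w lift_w0.
have [h y | v [eqv_v vE]] := @equivariant_build _ _ _ v0.
  by apply: (canLR w0K); rewrite equivariant_act ?v0K.
have [||i _] := @cell2_eq1 _ _ _ _ (id1 Y) (v \o1 w0).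
- by move=> y; rewrite /= vE w0K.
- by move=> y h; rewrite /= eqv_w0 eqv_v.
have [||j _] := @cell2_eq1 _ _ _ _ (w0 \o1 v) (id1 Y').
- by move=> y; rewrite /= vE v0K.
- by move=> y h; rewrite /= eqv_w0 eqv_v.
exists v; split; split; first exact: vcomp (whiskl v z) i.
exact: vcomp j (whiskr z' v).
Qed.

End Lifting.

Theorem proposition4p2p7 :
  (* (0) *)
  ((forall (G H K : finGroupType) (X : gset G) (Y : gset H) (Z : gset K)
       (a : cell1 X Y) (b : cell1 Y Z),
      stab_surj a -> stab_surj b -> stab_surj (b \o1 a)) /\
   (forall (G : finGroupType) (X Y Z : gset G)
       (a : cell1 X Y) (b : cell1 Y Z),
      equivariant a -> equivariant b -> equivariant (b \o1 a))) /\
  (* (1) *)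
  (forall (G H : finGroupType) (X : gset G) (Y : gset H) (a : cell1 X Y),
     exists (Z : gset H) (s : cell1 X Z) (u : cell1 Z Y),
       stab_surj s /\ equivariant u /\ inhabited (cell2 (u \o1 s) a)) /\
  (* (2) and (3) *)
  (forall (G H : finGroupType) (X : gset G) (Y Y' Z : gset H)
      (a : cell1 X Y) (b : cell1 X Y') (c : cell1 Y Z) (d : cell1 Y' Z)
      (e : cell2 (c \o1 a) (d \o1 b)),
    stab_surj a -> stab_surj b -> equivariant c -> equivariant d ->
    (* (2)(i) *)
    (exists (w : cell1 Y Y') (m : cell2 (w \o1 a) b) (n : cell2 (d \o1 w) c),
       lifting e m n) /\
    (* (2)(ii) *)
    (forall (w : cell1 Y Y') (m : cell2 (w \o1 a) b) (n : cell2 (d \o1 w) c)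
        (w' : cell1 Y Y') (m' : cell2 (w' \o1 a) b) (n' : cell2 (d \o1 w') c),
       lifting e m n -> lifting e m' n' ->
       exists! z : cell2 w w',
         vcomp m' (whiskr z a) = m /\ vcomp n' (whiskl d z) = n) /\
    (* (3) *)
    (forall (w : cell1 Y Y') (m : cell2 (w \o1 a) b) (n : cell2 (d \o1 w) c),
       lifting e m n -> equivalence1 w) /\
    (exists (w : cell1 Y Y') (m : cell2 (w \o1 a) b) (n : cell2 (d \o1 w) c),
       lifting e m n /\ equivariant w /\ bijective w)).
Proof.
split.
  split; first exact: stab_surj_comp.
  by move=> G X Y Z a b eqv_a eqv_b x g; rewrite /= eqv_a eqv_b.
split; first exact: stab_surj_equivariant_factor.
move=> G H X Y Y' Z a b c d e a_ss b_ss eqv_c eqv_d; split.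
  have [w [m [n [lift_w _]]]] :=
    exists_bijective_lifting e a_ss b_ss eqv_c eqv_d.
  by exists w, m, n.
split=> [w m n w' m' n'|]; first exact: exists_lifting_cell2.
split=> [w m n|]; first exact: lifting_equivalence1.
exact: exists_bijective_lifting.
Qed.
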